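(* Let $k,n,p\ge1$ and let $c\in\mathbb{T}_p$. The following are equivalent: (i) $c\in\mathbb{T}_p^+$; that is, $\widehat c[\ell]\ge0$ for each $\ell\in[p]$. (ii) $\Phi_c$ weakly preserves positivity, meaning that for every order $2k+1$ $t$-Hermitian positive semidefinite hypermatrix $\mathcal{A}\in\mathbb{C}^{n\times\dots\times n\times p}$, $h_{\Phi_c(\mathcal{A})}$ is Hermitian positive semidefinite. Additionally, the following are equivalent: (a) $c\in\mathbb{T}_p^+\setminus\{0\}$; that is, $\widehat c[\ell]\ge0$ for all $\ell\in[p]$ and $\widehat c[\ell_*]>0$ for at least one $\ell_*\in[p]$. (b) $\Phi_c$ strongly preserves positivity, meaning that for every order $2k+1$ $t$-Hermitian positive definite hypermatrix $\mathcal{A}\in\mathbb{C}^{n\times\dots\times n\times p}$, $h_{\Phi_c(\mathcal{A})}$ is Hermitian positive definite.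
   Context: Notation: $[m]=\{1,\dots,m\}$; a hypermatrix of order $N$ is an element of $\mathbb{C}^{n_1\times\dots\times n_N}$. For a tube $a\in\mathbb{C}^p$, $\widehat a=\mathrm{fft}(a)$ is the unnormalized discrete Fourier transform $\widehat a[\ell]=\sum_{m=1}^p e^{-2\pi i(\ell-1)(m-1)/p}a[m]$. For a hypermatrix whose last mode (the tubal mode) has length $p$, the hat denotes applying $\mathrm{fft}$ along that mode, and the subscript $(\ell)$ denotes the $\ell$-th frontal slice, i.e. the last index fixed equal to $\ell$. Conjugate partial symmetry: an order $2k$ hypermatrix $\mathcal{B}=[b_{i_1\dots i_kj_1\dots j_k}]\in\mathbb{C}^{n\times\dots\times n}$ is conjugate partially symmetric if $\overline{b_{j_{\sigma(1)}\dots j_{\sigma(k)}i_{\tau(1)}\dots i_{\tau(k)}}}=b_{i_1\dots i_kj_1\dots j_k}$ for all indices and all $\sigma,\tau\in S_k$. An order $2k+1$ hypermatrix $\mathcal{A}\in\mathbb{C}^{n\times\dots\times n\times p}$ is $t$-conjugate partially symmetric if every $\widehat{\mathcal{A}}_{(\ell)}$, $\ell\in[p]$, is conjugate partially symmetric. Classical forms: for an order $2k$ hypermatrix $\mathcal{B}\in\mathbb{C}^{n\times\dots\times n}$, $h_{\mathcal{B}}(z)=\sum b_{i_1\dots i_kj_1\dots j_k}\overline{z_{i_1}}\cdots\overline{z_{i_k}}z_{j_1}\cdots z_{j_k}$ for $z\in\mathbb{C}^n$; $h_{\mathcal{B}}$ is Hermitian positive definite (semidefinite) if $h_{\mathcal{B}}(z)$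 is real and $>0$ ($\ge0$) for all nonzero $z\in\mathbb{C}^n$. $t$-Hermitian forms: $\mathbb{T}_p=\mathbb{C}^{1\times1\times p}\cong\mathbb{C}^p$ is the algebra of tubes with product the circular convolution $(a\circledast b)[\ell]=\sum_{m=1}^p a[m]\,b[((\ell-m)\bmod p)+1]$, and $\mathbb{T}_p^n\cong\mathbb{C}^{n\times1\times p}$. Fourier conjugation $J$ acts on tubes by $J(a)[\ell+1]=\overline{a[((-\ell)\bmod p)+1]}$, $\ell=0,\dots,p-1$. For a $t$-conjugate partially symmetric $\mathcal{A}$ and $\mathcal{Z}\in\mathbb{T}_p^n$ with tubes $\mathcal{Z}[i,:]$, $h_{\mathcal{A}}(\mathcal{Z})=\sum \mathcal{A}[i_1,\dots,i_k,j_1,\dots,j_k,:]\circledast J(\mathcal{Z}[i_1,:])\circledast\cdots\circledast J(\mathcal{Z}[i_k,:])\circledast\mathcal{Z}[j_1,:]\circledast\cdots\circledast\mathcal{Z}[j_k,:]\in\mathbb{T}_p$, summing over all indices in $[n]$. $t$-positivity: $\mathbb{T}_p^+=\{a\in\mathbb{T}_p:\widehat a[\ell]\ge0\text{ for all }\ell\in[p]\}$. An order $2k+1$ hypermatrix $\mathcal{A}$ is $t$-Hermitian positive definite (semidefinite) if it is $t$-conjugate partially symmetric and $h_{\mathcal{A}}(\mathcal{Z})\in\mathbb{T}_p^+\setminus\{0\}$ ($\in\mathbb{T}_p^+$) for all nonzero $\mathcal{Z}\in\mathbb{T}_p^n$. Contraction: for $c\in\mathbb{T}_p$ and an order $2k+1$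 hypermatrix $\mathcal{A}\in\mathbb{C}^{n\times\dots\times n\times p}$, the $c$-contraction hypermatrix is the order $2k$ hypermatrix $\Phi_c(\mathcal{A})=\sum_{\ell=1}^p\overline{c[\ell]}\,\mathcal{A}_{(\ell)}$. *)

(* Defs.v *)
From mathcomp Require Import all_boot all_order all_fingroup all_algebra.
From mathcomp Require Import complex.
From mathcomp Require Import all_classical all_reals all_analysis.

Set Implicit Arguments.
Unset Strict Implicit.
Unset Printing Implicit Defensive.

Import Order.TTheory GRing.Theory Num.Theory.

Local Open Scope ring_scope.

(* Indices are 0-based throughout: 'I_p stands for [p], with i : 'I_p in the
   place of i + 1. On R[i], "0 <= z" means that z is real and nonnegative, and
   "0 < z" that z is real and positive. *)

Section Tubes.
Variables (R : realType) (p : nat).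

Definition tube := 'rV[R[i]]_p.

Lemma cyc_sub_subproof (l m : 'I_p) : ((l + p - m) %% p < p)%N.
Proof. by rewrite ltn_mod (leq_ltn_trans _ (ltn_ord l)). Qed.

(* (l - m) mod p; the summand p keeps the subtraction on nat from truncating. *)
Definition cyc_sub (l m : 'I_p) : 'I_p := Ordinal (cyc_sub_subproof l m).

Lemma cyc_opp_subproof (l : 'I_p) : ((p - l) %% p < p)%N.
Proof. by rewrite ltn_mod (leq_ltn_trans _ (ltn_ord l)). Qed.

Definition cyc_opp (l : 'I_p) : 'I_p := Ordinal (cyc_opp_subproof l).

Definition expi (x : R) : R[i] := (cos x +i* sin x)%C.

Definition fft (a : tube) : tube :=
  \row_l \sum_(m < p) expi (- (2 * pi * (l * m)%:R / p%:R)) * a 0 m.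

Definition tconv (a b : tube) : tube :=
  \row_l \sum_(m < p) a 0 m * b 0 (cyc_sub l m).

(* The unit of tconv. *)
Definition tone : tube := \row_l (val l == 0%N)%:R.

Definition fconj (a : tube) : tube := \row_l (a 0 (cyc_opp l))^*.

Definition tnonneg (a : tube) : Prop := forall l : 'I_p, 0 <= fft a 0 l.

End Tubes.

Definition mindex (k n : nat) := {ffun 'I_k -> 'I_n}.

Definition mperm (k n : nat) (i : mindex k n) (s : 'S_k) : mindex k n :=
  [ffun m => i (s m)].

(* With T the scalars, an order 2k hypermatrix; with T the tubes of length p,
   an order 2k+1 hypermatrix whose last mode is the tubal one. The first 2k
   modes are grouped into the two blocks i_1...i_k and j_1...j_k. *)
Definition hypermx (T : Type) (k n : nat) :=
  {ffun mindex k n * mindex k n -> T}.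

Section Forms.
Variables (R : realType) (k n : nat).

Definition conj_part_sym (B : hypermx R[i] k n) : Prop :=
  forall (i j : mindex k n) (s t : 'S_k),
    (B (mperm j s, mperm i t))^* = B (i, j).

Definition hform (B : hypermx R[i] k n) (z : 'rV[R[i]]_n) : R[i] :=
  \sum_(i : mindex k n) \sum_(j : mindex k n)
    B (i, j) * (\prod_(m < k) (z 0 (i m))^*) * \prod_(m < k) z 0 (j m).

Definition herm_pd (B : hypermx R[i] k n) : Prop :=
  forall z : 'rV[R[i]]_n, z != 0 -> 0 < hform B z.

Definition herm_psd (B : hypermx R[i] k n) : Prop :=
  forall z : 'rV[R[i]]_n, z != 0 -> 0 <= hform B z.

Variable p : nat.

Definition hat (A : hypermx (tube R p) k n) : hypermx (tube R p) k n :=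
  [ffun ij => fft (A ij)].

Definition slice (A : hypermx (tube R p) k n) (l : 'I_p) : hypermx R[i] k n :=
  [ffun ij => A ij 0 l].

Definition t_conj_part_sym (A : hypermx (tube R p) k n) : Prop :=
  forall l : 'I_p, conj_part_sym (slice (hat A) l).

(* A vector of n tubes is an n x p matrix whose rows are the tubes. *)
Definition thform (A : hypermx (tube R p) k n) (Z : 'M[R[i]]_(n, p)) :
    tube R p :=
  \sum_(i : mindex k n) \sum_(j : mindex k n)
    tconv (tconv (A (i, j))
             (\big[@tconv R p/@tone R p]_(m < k) fconj (row (i m) Z)))
      (\big[@tconv R p/@tone R p]_(m < k) row (j m) Z).

Definition t_herm_pd (A : hypermx (tube R p) k n) : Prop :=
  t_conj_part_sym A /\
  forall Z : 'M[R[i]]_(n, p),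
    Z != 0 -> tnonneg (thform A Z) /\ thform A Z != 0.

Definition t_herm_psd (A : hypermx (tube R p) k n) : Prop :=
  t_conj_part_sym A /\
  forall Z : 'M[R[i]]_(n, p), Z != 0 -> tnonneg (thform A Z).

Definition contraction (c : tube R p) (A : hypermx (tube R p) k n) :
    hypermx R[i] k n :=
  [ffun ij => \sum_(l < p) (c 0 l)^* * slice A l ij].

Definition weakly_preserves_positivity (c : tube R p) : Prop :=
  forall A : hypermx (tube R p) k n,
    t_herm_psd A -> herm_psd (contraction c A).

Definition strongly_preserves_positivity (c : tube R p) : Prop :=
  forall A : hypermx (tube R p) k n,
    t_herm_pd A -> herm_pd (contraction c A).

End Forms.

(* Main.v *)
(* The discrete Fourier transform turns convolution into the slicewise product
   and Fourier conjugation into slicewise conjugation, so the l-th coefficient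
   of the transform of h_A(Z) is the classical form of the l-th slice of hat A
   at the l-th slice of hat Z. By Parseval,
     p * h_(Phi_c A)(z) = sum_l conj(hat c[l]) * h_(hat A_(l))(z),
   so positivity passes from A to Phi_c A when hat c >= 0. Conversely, take
   hat A_(l) = a_l * B with a_l >= 0 and h_B(z) = sum_v |z_v|^(2k): preservation
   gives sum_l conj(hat c[l]) * a_l >= 0 (resp. > 0 when all a_l > 0). *)

Require Import Defs.
From mathcomp Require Import all_boot all_order all_fingroup all_algebra.
From mathcomp Require Import complex.
From mathcomp Require Import all_classical all_reals all_analysis.
From mathcomp Require Import lra.
Import Order.TTheory GRing.Theory Num.Theory.
Local Open Scope ring_scope.

Set Implicit Arguments.
Unset Strict Implicit.
Unset Printing Implicit Defensive.

(** * The primitive root of unity behind the transform *)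

Section RootOfUnity.
Variable R : realType.

Lemma expiD (x y : R) : expi (x + y) = expi x * expi y.
Proof. by apply/eqP; rewrite eq_complex /= cosD sinD eqxx /= addrC. Qed.

Lemma expi0 : expi 0 = 1 :> R[i].
Proof. by rewrite /expi cos0 sin0. Qed.

Lemma expiMn (x : R) (n : nat) : expi (n%:R * x) = expi x ^+ n.
Proof.
elim: n => [|n IHn]; first by rewrite mul0r expi0 expr0.
by rewrite -natr1 mulrDl mul1r expiD IHn exprSr.
Qed.

Lemma expiN_conj (x : R) : (expi x)^* = expi (- x).
Proof. by rewrite /expi cosN sinN. Qed.

(** The real part is cos x = 1 - 2 sin(x/2)^2, and sin(x/2) > 0 because x/2 lies strictly between 0
    and pi. *)
Lemma expi_neq1 (x : R) : 0 < x < 2 * pi -> expi x != 1.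
Proof.
move=> /andP[x0 x2]; rewrite eq_complex /= negb_and; apply/orP; left.
have xE : x = (x / 2) *+ 2 by rewrite -mulr_natr divfK ?pnatr_eq0.
rewrite xE cos_mulr2n cos2sin2 mulrnBl.
have s0 : 0 < sin (x / 2).
  by apply: sin_gt0_pi; rewrite divr_gt0 //= ltr_pdivrMr // mulrC.
have : 0 < sin (x / 2) ^+ 2 by rewrite exprn_gt0.
by move=> s2; apply/negP => /eqP; lra.
Qed.

Definition fft_root (p : nat) : R[i] := expi (- (2 * pi / p%:R)).

Lemma fft_rootX (p m : nat) :
  fft_root p ^+ m = expi (- (2 * pi * m%:R / p%:R)).
Proof. by rewrite -expiMn mulrN mulrA [m%:R * _]mulrC. Qed.

Lemma fft_root_conj (p : nat) : (fft_root p)^* * fft_root p = 1.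
Proof. by rewrite expiN_conj -expiD addNr expi0. Qed.

Lemma fft_root_prim (p : nat) : (0 < p)%N -> p.-primitive_root (fft_root p).
Proof.
move=> p0; have pR : 0 < p%:R :> R by rewrite ltr0n.
apply/andP; split=> //; apply/forallP => m; rewrite unity_rootE; apply/eqP.
(* The exponent [m.+1] ranges over 1, ..., p. At p the angle is a full turn; below p, up to sign, it
   lies strictly between 0 and 2 pi. *)
have [->|ltmp] := eqVneq m.+1 p.
  apply/eqP; rewrite fft_rootX mulfK ?gt_eqF //.
  by rewrite /expi cosN sinN [2 * _]mulrC mulr_natr cos2pi sin2pi oppr0.
rewrite fft_rootX -expiN_conj; apply/negbTE.
rewrite (can2_eq (@conjCK _) (@conjCK _)) conjC1; apply: expi_neq1.
rewrite divr_gt0 ?mulr_gt0 ?pi_gt0 ?ltr0n //=.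
rewrite ltr_pdivrMr // ltr_pM2l ?mulr_gt0 ?pi_gt0 //.
by rewrite ltr_nat ltn_neqAle ltmp ltn_ord.
Qed.

Lemma sum_expr_unity (F : fieldType) (p : nat) (x : F) :
  x ^+ p = 1 -> x != 1 -> \sum_(i < p) x ^+ i = 0.
Proof.
move=> xp x1; apply/eqP; have /eqP := subrX1 x p.
by rewrite xp subrr eq_sym mulf_eq0 subr_eq0 (negbTE x1).
Qed.

End RootOfUnity.

(** * Inversion, Parseval, and the transform of convolution and Fourier conjugation *)

Section Fourier.
Variables (R : realType) (p : nat).
Hypothesis p_gt0 : (0 < p)%N.
Local Notation w := (fft_root R p).
Local Notation wP := (@fft_root_prim R p p_gt0).

Definition fft_mx : 'M[R[i]]_p := \matrix_(m, l) w ^+ (l * m).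

Lemma fft_coef (a : tube R p) l : fft a 0 l = \sum_(m < p) w ^+ (l * m) * a 0 m.
Proof. by rewrite mxE; apply: eq_bigr => m _; rewrite fft_rootX. Qed.

Lemma fftE (a : tube R p) : fft a = a *m fft_mx.
Proof.
apply/rowP => l; rewrite fft_coef mxE; apply: eq_bigr => m _.
by rewrite mxE mulrC.
Qed.

(** Since the conjugate of w is its inverse, entry (m, m') is the geometric sum of the powers of
    w^(m - m'): p ones on the diagonal, and off it a full sum over a nontrivial p-th root of unity.
    Both invertibility of the transform and Parseval follow. *)
Lemma fft_mx_mulJ : fft_mx *m (map_mx Num.conj fft_mx^T) = p%:R%:M.
Proof.
apply/matrixP => m m'; rewrite !mxE.
under eq_bigr => l _ do
  rewrite !mxE rmorphXn /= mulnC exprM mulnC exprM -exprMn.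
have cw : w^* = w^-1.
  have w0 : w != 0 by rewrite (prim_root_eq0 wP) -lt0n.
  by apply: (mulIf w0); rewrite fft_root_conj mulVf.
have [<-|mm'] := eqVneq m m'.
  under eq_bigr => l _ do
    rewrite cw exprVn mulfV ?expf_neq0 ?(prim_root_eq0 wP) -?lt0n // expr1n.
  by rewrite sumr_const card_ord mulr1n.
rewrite mulr0n; apply: sum_expr_unity.
  rewrite cw exprMn -!exprM !(mulnC _ p) !exprM exprVn (prim_expr_order wP).
  by rewrite invr1 !expr1n mulr1.
rewrite cw exprVn; apply: contra mm' => /eqP /divr1_eq /eqP.
by rewrite (eq_prim_root_expr wP) !modn_small.
Qed.

Lemma fft_mx_unit : fft_mx \in unitmx.
Proof.
have p0 : p%:R != 0 :> R[i] by rewrite pnatr_eq0 -lt0n.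
have /mulmx1_unit[] // :
    fft_mx *m (p%:R^-1 *: (map_mx Num.conj fft_mx^T)) = 1%:M.
by rewrite -scalemxAr fft_mx_mulJ scale_scalar_mx mulVf.
Qed.

Definition ifft (b : 'rV[R[i]]_p) : tube R p := b *m invmx fft_mx.

Lemma ifftK b : fft (ifft b) = b.
Proof. by rewrite fftE mulmxKV ?fft_mx_unit. Qed.

Lemma fft_eq0 (a : tube R p) : (fft a == 0) = (a == 0).
Proof.
apply/eqP/eqP => [|->]; last by rewrite fftE mul0mx.
by move=> a0; rewrite -(mulmxK fft_mx_unit a) -fftE a0 mul0mx.
Qed.

Lemma fft_parseval (a c : tube R p) :
  \sum_(l < p) (fft c 0 l)^* * fft a 0 l =
    p%:R * \sum_(l < p) (c 0 l)^* * a 0 l.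
Proof.
have E (u v : tube R p) :
    \sum_(l < p) (v 0 l)^* * u 0 l = (u *m (map_mx Num.conj v^T)) 0 0.
  by rewrite mxE; apply: eq_bigr => l _; rewrite !mxE mulrC.
rewrite !E !fftE trmx_mul map_mxM /= mulmxA -(mulmxA a) fft_mx_mulJ.
by rewrite mul_mx_scalar -scalemxAl mxE.
Qed.

Lemma cyc_subK (j m : 'I_p) : ((cyc_sub j m + m) %% p = j)%N.
Proof.
rewrite /= modnDml subnK; first by rewrite modnDr modn_small.
by rewrite (leq_trans (ltnW (ltn_ord m))) ?leq_addl.
Qed.

Lemma fft_tconv (a b : tube R p) l :
  fft (tconv a b) 0 l = fft a 0 l * fft b 0 l.
Proof.
rewrite !fft_coef; under eq_bigr => j _ do rewrite mxE mulr_sumr.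
rewrite exchange_big /= mulr_suml; apply: eq_bigr => m _.
(* For fixed m the cyclic shift permutes the indices, so the inner sum can be reindexed by it. *)
have inj : injective (fun j => cyc_sub j m).
  move=> j j' /= jj'; apply: val_inj.
  by rewrite /= -(cyc_subK j m) jj' cyc_subK.
rewrite mulr_sumr [RHS](reindex_inj inj); apply: eq_bigr => j _.
(* Exponents of w only matter modulo p, and j is congruent to (j - m) + m. *)
have -> : w ^+ (l * j) = w ^+ (l * cyc_sub j m) * w ^+ (l * m).
  rewrite -exprD -mulnDr mulnC exprM -(cyc_subK j m) (prim_expr_mod wP).
  by rewrite -exprM mulnC.
by rewrite [_ ^+ _ * _ ^+ _]mulrC mulrACA.
Qed.

Lemma fft_tone l : fft (tone R p) 0 l = 1.
Proof.
rewrite fft_coef (bigD1 (Ordinal p_gt0)) //= big1 ?addr0.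
  by rewrite mxE eqxx mulr1 muln0 expr0.
move=> m; rewrite -val_eqE /= => /negbTE m0.
by rewrite mxE /= m0 mulr0.
Qed.

(** Index negation modulo p inverts the powers of w, which is the same as conjugating them. *)
Lemma fft_fconj (a : tube R p) l : fft (fconj a) 0 l = (fft a 0 l)^*.
Proof.
have oppK : involutive (@cyc_opp p).
  move=> m; apply: val_inj; rewrite /=.
  case: (posnP m) => [->|m0]; first by rewrite subn0 modnn subn0 modnn.
  have pm : (p - m < p)%N by rewrite ltn_subrL m0.
  by rewrite (modn_small pm) subKn ?modn_small // ltnW.
rewrite !fft_coef rmorph_sum (reindex_inj (inv_inj oppK)) /=.
apply: eq_bigr => m _; rewrite mxE oppK rmorphM; congr (_ * _).
(* After multiplication by w^(l m), both sides equal 1. *)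
rewrite rmorphXn; apply: (@mulIf _ (w ^+ (l * m))).
  by rewrite expf_neq0 // (prim_root_eq0 wP) -lt0n.
rewrite -exprMn fft_root_conj expr1n -exprD -mulnDr.
rewrite mulnC exprM -(prim_expr_mod wP) /= modnDml subnK ?(ltnW (ltn_ord m)) //.
by rewrite modnn expr0 expr1n.
Qed.

End Fourier.

(** * Reduction of tubal forms to classical forms on Fourier slices *)

Section TubalForms.
Variables (R : realType) (k n p : nat).
Hypothesis p_gt0 : (0 < p)%N.

Definition hat_slice (Z : 'M[R[i]]_(n, p)) (l : 'I_p) : 'rV[R[i]]_n :=
  \row_i fft (row i Z) 0 l.

Lemma fft_sum (I : finType) (F : I -> tube R p) l :
  fft (\sum_i F i) 0 l = \sum_i fft (F i) 0 l.
Proof.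
rewrite fftE mulmx_suml summxE; apply: eq_bigr => i _.
by rewrite fftE.
Qed.

Lemma fft_tprod (I : finType) (F : I -> tube R p) l :
  fft (\big[@tconv R p/@tone R p]_i F i) 0 l = \prod_i fft (F i) 0 l.
Proof.
by apply: (big_morph (fun a => fft a 0 l)) => [a b|];
  rewrite ?fft_tconv ?fft_tone //.
Qed.

Lemma fft_thform (A : hypermx (tube R p) k n) Z l :
  fft (thform A Z) 0 l = hform (slice (hat A) l) (hat_slice Z l).
Proof.
rewrite fft_sum; apply: eq_bigr => i _; rewrite fft_sum; apply: eq_bigr => j _.
rewrite !fft_tconv // !fft_tprod !ffunE; congr (_ * _ * _).
  by apply: eq_bigr => m _; rewrite fft_fconj // [in RHS]mxE.
by apply: eq_bigr => m _; rewrite [in RHS]mxE.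
Qed.

(** Parseval is applied to the tube at each pair of multi-indices, after moving the sum over l
    innermost. *)
Lemma hform_contraction (c : tube R p) (A : hypermx (tube R p) k n) z :
  p%:R * hform (Defs.contraction c A) z =
  \sum_(l < p) (fft c 0 l)^* * hform (slice (hat A) l) z.
Proof.
rewrite mulr_sumr; under [RHS]eq_bigr => l _ do rewrite mulr_sumr.
rewrite exchange_big; apply: eq_bigr => i _ /=.
rewrite mulr_sumr; under [RHS]eq_bigr => l _ do rewrite mulr_sumr.
rewrite exchange_big; apply: eq_bigr => j _ /=.
rewrite ffunE !mulrA.
under [X in p%:R * X]eq_bigr => l _ do rewrite ffunE.
rewrite -fft_parseval // !mulr_suml; apply: eq_bigr => l _.
by rewrite !ffunE !mulrA.
Qed.

(** Inverting the transform tube by tube lets the Fourier slices be prescribed independently; this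
    is the source of all test vectors Z. *)
Lemma hat_slice_exists (z : 'I_p -> 'rV[R[i]]_n) :
  exists Z : 'M[R[i]]_(n, p), forall l, hat_slice Z l = z l.
Proof.
exists (\matrix_i ifft (\row_l z l 0 i)) => l.
by apply/rowP => i; rewrite [LHS]mxE rowK ifftK // mxE.
Qed.

Lemma hat_slice_eq0 (Z : 'M[R[i]]_(n, p)) :
  (forall l, hat_slice Z l = 0) -> Z = 0.
Proof.
move=> Z0; apply/row_matrixP => i; rewrite row0; apply/eqP.
rewrite -(fft_eq0 p_gt0); apply/eqP/rowP => l.
by have /rowP/(_ i) := Z0 l; rewrite !mxE.
Qed.

Lemma hat_slice0 l : hat_slice 0 l = 0.
Proof. by apply/rowP => i; rewrite mxE fftE row0 mul0mx !mxE. Qed.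

Lemma hform0 (B : hypermx R[i] k n) : (0 < k)%N -> hform B 0 = 0.
Proof.
move=> k0; rewrite /hform big1 // => i _; rewrite big1 // => j _.
by rewrite [X in _ * X](bigD1 (Ordinal k0)) //= mxE mul0r mulr0.
Qed.

(** The test vector has all its Fourier slices equal to z, so the l-th coefficient of its tubal form
    is the wanted classical value. *)
Lemma t_herm_psd_hat (A : hypermx (tube R p) k n) :
  t_herm_psd A -> forall l, herm_psd (slice (hat A) l).
Proof.
move=> [_ hA] l z z0.
have [Z hZ] := hat_slice_exists (fun=> z).
rewrite -(hZ l) -fft_thform; apply: hA.
by apply: contra_neq z0 => Z0; rewrite -(hZ l) Z0 hat_slice0.
Qed.

(* Testing on the vector of tubes whose Fourier slices are [z] at [l] and [0]
   elsewhere isolates the [l]-th classical form. *)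
Lemma t_herm_pd_hat (A : hypermx (tube R p) k n) :
  (0 < k)%N -> t_herm_pd A -> forall l, herm_pd (slice (hat A) l).
Proof.
move=> k0 [_ hA] l z z0.
have [Z hZ] := hat_slice_exists (fun l' => if l' == l then z else 0).
have hZl : hat_slice Z l = z by rewrite hZ eqxx.
have [|h1 h2] := hA Z.
  by apply: contra_neq z0 => Z0; rewrite -hZl Z0 hat_slice0.
rewrite lt_def -hZl -fft_thform h1 andbT.
(* The other coefficients are forms evaluated at 0, so if the l-th one vanished as well, the whole
   tube would be 0. *)
apply: contra_neq h2 => h0; apply/eqP; rewrite -(fft_eq0 p_gt0).
apply/eqP/rowP => l'; rewrite [RHS]mxE.
have [->//|ne] := eqVneq l' l.
by rewrite fft_thform hZ (negbTE ne) hform0.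
Qed.

End TubalForms.

(** * Diagonal test hypermatrices with prescribed Fourier weights *)

Section DiagonalForms.
Variables (R : realType) (k n p : nat).
Hypotheses (k_gt0 : (0 < k)%N) (p_gt0 : (0 < p)%N).

(** For k >= 1 this is the identity hypermatrix: 1 where all 2k indices agree, 0 elsewhere. Summing
    products over v makes the i and j sums decouple in the form. *)
Definition diag_hypermx : hypermx R[i] k n :=
  [ffun ij => \sum_v (ij.1 == [ffun=> v])%:R * (ij.2 == [ffun=> v])%:R].

Lemma mperm_const (i : mindex k n) s v :
  (mperm i s == [ffun=> v]) = (i == [ffun=> v]).
Proof.
apply/eqP/eqP => [/ffunP E|->]; last by apply/ffunP => m; rewrite !ffunE.
by apply/ffunP => m; have := E ((s^-1)%g m); rewrite !ffunE permKV.
Qed.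

Lemma hform_diag z : hform diag_hypermx z = \sum_v `|z 0 v| ^+ 2 ^+ k.
Proof.
pose f v (i : mindex k n) : R[i] := (i == [ffun=> v])%:R.
have sumf v (F : mindex k n -> R[i]) : \sum_i f v i * F i = F [ffun=> v].
  rewrite (bigD1 [ffun=> v]) //= /f eqxx mul1r big1 ?addr0 // => i /negbTE ->.
  by rewrite mul0r.
transitivity (\sum_v (\sum_i f v i * \prod_(m < k) (z 0 (i m))^*) *
                     (\sum_j f v j * \prod_(m < k) z 0 (j m))).
  under [RHS]eq_bigr => v _ do rewrite mulr_suml.
  rewrite exchange_big; apply: eq_bigr => i _ /=.
  under [RHS]eq_bigr => v _ do rewrite mulr_sumr.
  rewrite exchange_big; apply: eq_bigr => j _ /=.
  rewrite ffunE !mulr_suml; apply: eq_bigr => v _ /=.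
  by rewrite -mulrA mulrACA.
apply: eq_bigr => v _; rewrite !sumf.
under eq_bigr => m _ do rewrite ffunE.
under [X in _ * X]eq_bigr => m _ do rewrite ffunE.
by rewrite !prodr_const card_ord -exprMn normCK mulrC.
Qed.

Lemma hform_diag_ge0 z : 0 <= hform diag_hypermx z.
Proof. by rewrite hform_diag sumr_ge0 // => v _; rewrite !exprn_ge0. Qed.

Lemma hform_diag_eq0 z : (hform diag_hypermx z == 0) = (z == 0).
Proof.
apply/idP/eqP => [|->]; last by rewrite hform0.
rewrite hform_diag psumr_eq0 => [/allP h|v _]; last by rewrite !exprn_ge0.
apply/rowP => v; have := h v (mem_index_enum v).
by rewrite !mxE !expf_eq0 /= k_gt0 /= normr_eq0 => /eqP.
Qed.

Definition tdiag (a : 'rV[R[i]]_p) : hypermx (tube R p) k n :=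
  [ffun ij => diag_hypermx ij *: ifft a].

Lemma slice_hat_tdiag a l ij :
  slice (hat (tdiag a)) l ij = a 0 l * diag_hypermx ij.
Proof. by rewrite !ffunE fftE -scalemxAl -fftE ifftK // mxE mulrC. Qed.

Lemma hform_tdiag a l z :
  hform (slice (hat (tdiag a)) l) z = a 0 l * hform diag_hypermx z.
Proof.
rewrite mulr_sumr; apply: eq_bigr => i _; rewrite mulr_sumr.
by apply: eq_bigr => j _; rewrite slice_hat_tdiag !mulrA.
Qed.

Lemma tdiag_sym (a : 'rV[R[i]]_p) :
  (forall l, 0 <= a 0 l) -> t_conj_part_sym (tdiag a).
Proof.
move=> a0 l i j s t; rewrite !slice_hat_tdiag rmorphM /=.
rewrite conj_Creal ?ger0_real //; congr (_ * _).
rewrite !ffunE rmorph_sum; apply: eq_bigr => v _ /=.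
by rewrite !mperm_const rmorphM !rmorph_nat mulrC.
Qed.

Lemma tdiag_psd (a : 'rV[R[i]]_p) :
  (forall l, 0 <= a 0 l) -> t_herm_psd (tdiag a).
Proof.
move=> a0; split; first exact: tdiag_sym.
by move=> Z _ l; rewrite fft_thform // hform_tdiag mulr_ge0 ?hform_diag_ge0.
Qed.

Lemma tdiag_pd (a : 'rV[R[i]]_p) : (forall l, 0 < a 0 l) -> t_herm_pd (tdiag a).
Proof.
move=> a0; have [sym psd] : t_herm_psd (tdiag a).
  by apply: tdiag_psd => l; rewrite ltW.
split=> // Z Z0; split; first exact: psd.
(* Definiteness: if the tube vanishes, each positive weight can be cancelled, and the diagonal form
   vanishes only at 0. *)
apply: contra_neq Z0 => h0; apply: (hat_slice_eq0 p_gt0) => l; apply/eqP.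
have : fft (thform (tdiag a) Z) 0 l = 0 by rewrite h0 fftE mul0mx mxE.
move/eqP; rewrite fft_thform // hform_tdiag mulf_eq0 gt_eqF //=.
by rewrite hform_diag_eq0.
Qed.

Lemma contraction_tdiag (c : tube R p) a z :
  p%:R * hform (Defs.contraction c (tdiag a)) z =
  (\sum_l (fft c 0 l)^* * a 0 l) * hform diag_hypermx z.
Proof.
rewrite hform_contraction // mulr_suml; apply: eq_bigr => l _.
by rewrite hform_tdiag mulrA.
Qed.

Hypothesis n_gt0 : (0 < n)%N.

Lemma const_mx1_neq0 : const_mx 1 != 0 :> 'rV[R[i]]_n.
Proof.
apply/eqP => /rowP/(_ (Ordinal n_gt0)); rewrite !mxE => /eqP.
by rewrite oner_eq0.
Qed.

(** Evaluating the contraction of [tdiag a] at the all-ones vector gives the pairing up to positive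
    factors; n > 0 makes that vector nonzero. *)
Lemma weakly_preserves_pairing (c : tube R p) (a : 'rV[R[i]]_p) :
  weakly_preserves_positivity k n c -> (forall l, 0 <= a 0 l) ->
  0 <= \sum_l (fft c 0 l)^* * a 0 l.
Proof.
move=> hc a0; have z0 := const_mx1_neq0.
have := hc _ (tdiag_psd a0) _ z0.
rewrite -(pmulr_rge0 _ (_ : 0 < p%:R)) ?ltr0n // contraction_tdiag.
by rewrite pmulr_lge0 // lt_def hform_diag_eq0 z0 hform_diag_ge0.
Qed.

Lemma strongly_preserves_pairing (c : tube R p) (a : 'rV[R[i]]_p) :
  strongly_preserves_positivity k n c -> (forall l, 0 < a 0 l) ->
  0 < \sum_l (fft c 0 l)^* * a 0 l.
Proof.
move=> hc a0; have z0 := const_mx1_neq0.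
have := hc _ (tdiag_pd a0) _ z0.
rewrite -(pmulr_rgt0 _ (_ : 0 < p%:R)) ?ltr0n // contraction_tdiag.
by rewrite pmulr_lgt0 // lt_def hform_diag_eq0 z0 hform_diag_ge0.
Qed.

End DiagonalForms.

(** * The two equivalences, from slicewise positivity and weighted pairings *)

Section Preservation.
Variables (R : realType) (k n p : nat).
Hypotheses (k_gt0 : (0 < k)%N) (n_gt0 : (0 < n)%N) (p_gt0 : (0 < p)%N).
Variable c : tube R p.

Lemma tnonneg_weakly_preserves :
  tnonneg c -> weakly_preserves_positivity k n c.
Proof.
move=> hc A hA z z0; rewrite -(pmulr_rge0 _ (_ : 0 < p%:R)) ?ltr0n //.
rewrite hform_contraction // sumr_ge0 // => l _.
by rewrite mulr_ge0 ?conjC_ge0 ?(t_herm_psd_hat p_gt0 hA).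
Qed.

Lemma weakly_preserves_tnonneg :
  weakly_preserves_positivity k n c -> tnonneg c.
Proof.
move=> hc l; have /= :=
  (* Weight 1 at l and 0 elsewhere reduces the pairing to the conjugate of the l-th coefficient. *)
  weakly_preserves_pairing k_gt0 p_gt0 n_gt0 (a := delta_mx 0 l) hc.
rewrite (bigD1 l) //= big1 => [|m /negbTE ml]; last first.
  by rewrite [X in _ * X]mxE ml andbF mulr0.
rewrite addr0 [delta_mx _ _ _ _]mxE !eqxx mulr1 conjC_ge0; apply=> m.
by rewrite mxE ler0n.
Qed.

Lemma tnonneg_neq0P :
  tnonneg c -> (c != 0 <-> exists l : 'I_p, 0 < fft c 0 l).
Proof.
move=> hc; split=> [|[l hl]]; last first.
  by apply: contraTneq hl => ->; rewrite fftE mul0mx mxE ltxx.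
rewrite -(fft_eq0 p_gt0) => /rV0Pn[l hl].
by exists l; rewrite lt_def hl hc.
Qed.

Lemma tpos_strongly_preserves :
  tnonneg c -> c != 0 -> strongly_preserves_positivity k n c.
Proof.
move=> hc /(tnonneg_neq0P hc)[l hl] A hA z z0.
have hAz m : 0 < hform (slice (hat A) m) z by exact: t_herm_pd_hat.
rewrite -(pmulr_rgt0 _ (_ : 0 < p%:R)) ?ltr0n // hform_contraction //.
(* The term at l is strictly positive and the remaining ones are nonnegative. *)
rewrite (bigD1 l) //= ltr_pwDl //.
  by rewrite mulr_gt0 // lt_def conjC_eq0 gt_eqF //= conjC_ge0.
by rewrite sumr_ge0 // => m _; rewrite mulr_ge0 ?conjC_ge0 // ltW.
Qed.

(* Pairing with positive weights [a] that equal 1 off [l] and [t] at [l] gives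
   [0 < t * x + s] for all [t > 0]: [t = 1, 2] shows that [x] is real, and
   [x < 0] is excluded by the [t] with [t * x + s = 0]. *)
Lemma strongly_preserves_tnonneg :
  strongly_preserves_positivity k n c -> tnonneg c.
Proof.
move=> hc l; rewrite -conjC_ge0; set x := (fft c 0 l)^*.
pose s := \sum_(m | m != l) (fft c 0 m)^*.
have lin t : 0 < t -> 0 < t * x + s.
  move=> t0; pose a : 'rV[R[i]]_p := \row_m (if m == l then t else 1).
  have a0 m : 0 < a 0 m by rewrite mxE; case: ifP.
  have := strongly_preserves_pairing k_gt0 p_gt0 n_gt0 hc a0.
  rewrite (bigD1 l) //= [a _ _]mxE eqxx [_ * t]mulrC.
  under eq_bigr => m /negbTE ml do rewrite [a _ _]mxE ml mulr1.
  by [].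
have h1 := lin 1 ltr01; have h2 := lin 2 (ltr0n _ 2).
have xr : x \is Num.real.
  have -> : x = (2 * x + s) - (1 * x + s).
    by rewrite mul1r opprD addrACA subrr addr0 mulr2n mulrDl mul1r addrK.
  by rewrite rpredB // gtr0_real.
rewrite real_leNgt ?real0 //; apply/negP => x0.
(* This t is -s / x, written so that its positivity follows from x + s > 0 and -x > 0. *)
have := lin (1 + (1 * x + s) / - x).
rewrite addr_gt0 ?divr_gt0 ?oppr_gt0 // => /(_ isT).
rewrite mulrDl invrN mulrN mulNr mulfVK ?lt_eqF // opprD addrA subrr add0r.
by rewrite addNr ltxx.
Qed.

(** With all weights equal to 1 the pairing must be strictly positive, whereas c = 0 would make it
    0. *)
Lemma strongly_preserves_neq0 :
  strongly_preserves_positivity k n c -> c != 0.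
Proof.
move=> hc; have h :=
  strongly_preserves_pairing k_gt0 p_gt0 n_gt0 (a := const_mx 1) hc.
apply/eqP => c0; suff: (0 : R[i]) < 0 by rewrite ltxx.
have /h : forall l, 0 < (const_mx 1 : 'rV[R[i]]_p) 0 l by move=> l; rewrite mxE.
by rewrite c0 fftE mul0mx big1 // => l _; rewrite [X in X^*]mxE conjC0 mul0r.
Qed.

End Preservation.

Theorem theorem4p4 (R : realType) (k n p : nat)
    (hk : (1 <= k)%N) (hn : (1 <= n)%N) (hp : (1 <= p)%N) (c : tube R p) :
  (tnonneg c <-> weakly_preserves_positivity k n c) /\
  ((tnonneg c /\ c != 0) <-> (tnonneg c /\ exists l : 'I_p, 0 < fft c 0 l)) /\
  ((tnonneg c /\ c != 0) <-> strongly_preserves_positivity k n c).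
Proof.
split; first by split;
  [exact: tnonneg_weakly_preserves | exact: weakly_preserves_tnonneg].
split.
  by split=> -[hc]; move/(tnonneg_neq0P hp hc).
split=> [[]|hc]; first exact: tpos_strongly_preserves.
split; first exact: strongly_preserves_tnonneg hc.
exact: strongly_preserves_neq0 hc.
Qed.
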